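(* Let $H$ be a finite index set, and let $D=(D_{ij})_{i,j\in H}$ and $G=(G_{ij})_{i,j\in H}$ be complex matrices with $\det D\neq 0$. There exists a unique family $(Q_i(w))_{i\in H}$ of power series in $\mathbb{C}[[w]]$, $w=(w_i)_{i\in H}$, with constant terms $1$, satisfying $$\prod_{j\in H}(Q_j(w))^{D_{ij}}+w_i\prod_{j\in H}(Q_j(w))^{G_{ij}}=1\qquad (i\in H).$$ It is given by $$Q_i(w)=\prod_{j\in H}(Q'_j(w))^{(D^{-1})_{ij}}\qquad (i\in H),$$ where $(Q'_i(w))_{i\in H}$ is the unique family of power series with constant terms $1$ satisfying $$Q'_i(w)+w_i\prod_{j\in H}(Q'_j(w))^{G'_{ij}}=1\qquad (i\in H),\qquad G'=GD^{-1}.$$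
   Context: For a power series $f(w)$ with constant term $1$ and $\alpha\in\mathbb{C}$, $(f(w))^\alpha\in\mathbb{C}[[w]]$ denotes the $\alpha$-th power of $f$ with constant term $1$, i.e. $\exp(\alpha\log f)$. *)

(* Defs.v *)
Set Warnings "-notation-overridden,-ambiguous-paths,-redundant-canonical-projection".
From HB Require Import structures.
From mathcomp Require Import all_boot all_order all_algebra.
From mathcomp Require Import boolp reals.
From mathcomp.real_closed Require Import complex.

Set Implicit Arguments.
Unset Strict Implicit.
Unset Printing Implicit Defensive.

Import GRing.Theory.
Local Open Scope ring_scope.

(* A monomial prod_(i : H) w_i ^ (m i) is represented by its exponent vector  *)
(* m : {ffun H -> nat}, with pointwise addition.                              *)
Section Exponents.
Variable H : finType.
Implicit Types m a b : {ffun H -> nat}.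

Definition edeg m : nat := (\sum_(i : H) m i)%N.

Definition ele a m : bool := [forall i, (a i <= m i)%N].

Definition esub m a : {ffun H -> nat} := [ffun i => (m i - a i)%N].

Definition eunit (i : H) : {ffun H -> nat} := [ffun j => (j == i : nat)].

(* The duplicate-free list of all a <= m; see ebelow_uniq and mem_ebelow.     *)
Definition ebelow m : seq {ffun H -> nat} :=
  [seq a <- [seq [ffun i => val (a i)] | a : {ffun H -> 'I_(edeg m).+1}]
     | ele a m].

Lemma leq_edeg m i : (m i <= edeg m)%N.
Proof. by rewrite /edeg (bigD1 i) //= leq_addr. Qed.

Lemma eleP a m : reflect (forall i, (a i <= m i)%N) (ele a m).
Proof. exact: forallP. Qed.

Lemma ebelow_uniq m : uniq (ebelow m).
Proof.
apply: filter_uniq; rewrite map_inj_uniq ?enum_uniq // => a b.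
by move/ffunP=> e; apply/ffunP=> i; apply: val_inj; have := e i; rewrite !ffunE.
Qed.

Lemma mem_ebelow m a : (a \in ebelow m) = ele a m.
Proof.
rewrite mem_filter; case: (boolP (ele a m)) => //= /eleP le_am.
apply/mapP; exists [ffun i => inord (a i) : 'I_(edeg m).+1].
  by rewrite mem_enum.
apply/ffunP=> i; rewrite !ffunE inordK // ltnS.
exact: leq_trans (le_am i) (leq_edeg m i).
Qed.

Lemma ele0 m : ele 0 m.
Proof. by apply/eleP=> i; rewrite ffunE. Qed.

Lemma ele_trans b a m : ele a b -> ele b m -> ele a m.
Proof. by move=> /eleP le_ab /eleP le_bm; apply/eleP=> i; apply: leq_trans. Qed.

Lemma esub0 m : esub m 0 = m.
Proof. by apply/ffunP=> i; rewrite !ffunE subn0. Qed.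

Lemma esub_sub m b c : esub (esub m b) c = esub m (b + c).
Proof. by apply/ffunP=> i; rewrite !ffunE subnDA. Qed.

Lemma addeK b c : esub (b + c) b = c.
Proof. by apply/ffunP=> i; rewrite !ffunE addKn. Qed.

Lemma edeg_eq0 m : (edeg m == 0%N) = (m == 0).
Proof.
rewrite /edeg sum_nat_eq0; apply/forallP/eqP=> [m0|-> i].
  by apply/ffunP=> i; rewrite ffunE; apply/eqP; apply: m0.
by rewrite ffunE.
Qed.

Lemma edeg_sub m a : ele a m -> (edeg a + edeg (esub m a) = edeg m)%N.
Proof.
move/eleP=> le_am; rewrite /edeg -big_split /=.
by apply: eq_bigr => i _; rewrite ffunE; apply: subnKC (le_am i).
Qed.

Lemma esubK a m : ele a m -> esub m (esub m a) = a.
Proof. by move/eleP=> le_am; apply/ffunP=> i; rewrite !ffunE subKn. Qed.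

Lemma ele_sub a m : ele (esub m a) m.
Proof. by apply/eleP=> i; rewrite ffunE leq_subr. Qed.

Lemma perm_ebelow_sub m : perm_eq (ebelow m) [seq esub m a | a <- ebelow m].
Proof.
apply: uniq_perm; first exact: ebelow_uniq.
  rewrite map_inj_in_uniq ?ebelow_uniq // => a b.
  by rewrite !mem_ebelow => le_am le_bm /(congr1 (esub m)); rewrite !esubK.
move=> a; rewrite mem_ebelow; apply/idP/mapP=> [le_am|[b _ ->]].
  by exists (esub m a); rewrite ?esubK // mem_ebelow ele_sub.
exact: ele_sub.
Qed.

Lemma perm_ebelow_shift m b : ele b m ->
  perm_eq [seq a <- ebelow m | ele b a]
          [seq b + c | c <- ebelow (esub m b)].
Proof.
move/eleP=> le_bm; apply: uniq_perm.
- by rewrite filter_uniq ?ebelow_uniq.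
- rewrite map_inj_uniq ?ebelow_uniq // => a c /ffunP e.
  by apply/ffunP=> i; have := e i; rewrite !ffunE => /addnI.
move=> a; rewrite mem_filter mem_ebelow.
apply/andP/mapP=> [[/eleP le_ba /eleP le_am]|[c]].
  exists (esub a b); last by apply/ffunP=> i; rewrite !ffunE; apply/esym/subnKC.
  by rewrite mem_ebelow; apply/eleP=> i; rewrite !ffunE leq_sub2r.
rewrite mem_ebelow => /eleP le_c ->; split; apply/eleP=> i; rewrite !ffunE.
  exact: leq_addr.
by have := le_c i; rewrite ffunE -(leq_add2l (b i)) subnKC.
Qed.

End Exponents.

(* Formal power series over K in the variables (w_i)_(i : H), given by their  *)
(* coefficient at each exponent vector.                                       *)
Record mpseries (H : finType) (K : Type) :=
  MPSeries { mpcoef : {ffun H -> nat} -> K }.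

Notation "f @_ m" := (mpcoef f m)
  (at level 3, m at level 2, left associativity, format "f @_ m") : ring_scope.

HB.instance Definition _ H K := gen_eqMixin (mpseries H K).
HB.instance Definition _ H K := gen_choiceMixin (mpseries H K).

Lemma mpseriesP H K (f g : mpseries H K) : (forall m, f@_m = g@_m) -> f = g.
Proof. by case: f g => [f] [g] /= e; congr MPSeries; apply/funext. Qed.

Section Ring.
Variables (H : finType) (K : comNzRingType).
Implicit Types f g h : mpseries H K.

Definition mps0 : mpseries H K := MPSeries (fun=> 0).
Definition mpsopp f := MPSeries (fun m => - f@_m).
Definition mpsadd f g := MPSeries (fun m => f@_m + g@_m).
Definition mpsscale (c : K) f := MPSeries (fun m => c * f@_m).
Definition mps1 : mpseries H K := MPSeries (fun m => (m == 0)%:R).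
Definition mpsmul f g :=
  MPSeries (fun m => \sum_(a <- ebelow m) f@_a * g@_(esub m a)).

Fact mpsaddA : associative mpsadd.
Proof. by move=> f g h; apply: mpseriesP => m /=; rewrite addrA. Qed.
Fact mpsaddC : commutative mpsadd.
Proof. by move=> f g; apply: mpseriesP => m /=; rewrite addrC. Qed.
Fact mpsadd0 : left_id mps0 mpsadd.
Proof. by move=> f; apply: mpseriesP => m /=; rewrite add0r. Qed.
Fact mpsaddN : left_inverse mps0 mpsopp mpsadd.
Proof. by move=> f; apply: mpseriesP => m /=; rewrite addNr. Qed.

HB.instance Definition _ := GRing.isZmodule.Build (mpseries H K)
  mpsaddA mpsaddC mpsadd0 mpsaddN.

Lemma mpcoef0 m : (0 : mpseries H K)@_m = 0. Proof. by []. Qed.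
Lemma mpcoefN f m : (- f)@_m = - f@_m. Proof. by []. Qed.
Lemma mpcoefD f g m : (f + g)@_m = f@_m + g@_m. Proof. by []. Qed.
Lemma mpcoefB f g m : (f - g)@_m = f@_m - g@_m. Proof. by []. Qed.

Fact mpsmulC : commutative mpsmul.
Proof.
move=> f g; apply: mpseriesP => m /=.
rewrite (perm_big _ (perm_ebelow_sub m)) big_map /= !big_seq.
by apply: eq_bigr => a; rewrite mem_ebelow => le_am; rewrite esubK // mulrC.
Qed.

Fact mpsmulA : associative mpsmul.
Proof.
move=> f g h; apply: esym; apply: mpseriesP => m /=.
transitivity (\sum_(a <- ebelow m) \sum_(b <- ebelow m | ele b a)
    f@_b * g@_(esub a b) * h@_(esub m a)).
  rewrite !big_seq; apply: eq_bigr => a; rewrite mem_ebelow => le_am.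
  rewrite mulr_suml -[RHS]big_filter; apply: perm_big; apply: uniq_perm.
  - exact: ebelow_uniq.
  - by rewrite filter_uniq ?ebelow_uniq.
  move=> b; rewrite mem_ebelow mem_filter mem_ebelow.
  by case: (boolP (ele b a)) => //= le_ba; rewrite (ele_trans le_ba).
rewrite (exchange_big_dep predT) //= [LHS]big_seq [RHS]big_seq.
apply: eq_bigr => b; rewrite mem_ebelow => le_bm.
rewrite -big_filter (perm_big _ (perm_ebelow_shift le_bm)) big_map mulr_sumr.
by apply: eq_bigr => c _; rewrite addeK esub_sub mulrA.
Qed.

Fact mpsmul1 : left_id mps1 mpsmul.
Proof.
move=> f; apply: mpseriesP => m /=.
rewrite (bigD1_seq 0) ?mem_ebelow ?ele0 ?ebelow_uniq //= eqxx mul1r esub0.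
by rewrite big1 ?addr0 // => a /negPf->; rewrite mul0r.
Qed.

Fact mpsmulDl : left_distributive mpsmul +%R.
Proof.
move=> f g h; apply: mpseriesP => m; rewrite mpcoefD -big_split /=.
by apply: eq_bigr => a _; rewrite mulrDl.
Qed.

Fact mps1_neq0 : mps1 != 0.
Proof.
apply/eqP=> /(congr1 (fun f : mpseries H K => f@_0)) /=.
by rewrite eqxx => /eqP; rewrite oner_eq0.
Qed.

HB.instance Definition _ := GRing.Zmodule_isComNzRing.Build (mpseries H K)
  mpsmulA mpsmulC mpsmul1 mpsmulDl mps1_neq0.

Lemma mpcoef1 m : (1 : mpseries H K)@_m = (m == 0)%:R. Proof. by []. Qed.
Lemma mpcoefM f g m :
  (f * g)@_m = \sum_(a <- ebelow m) f@_a * g@_(esub m a).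
Proof. by []. Qed.

Fact mpsscaleA a b f : mpsscale a (mpsscale b f) = mpsscale (a * b) f.
Proof. by apply: mpseriesP => m /=; rewrite mulrA. Qed.
Fact mpsscale1 : left_id 1 mpsscale.
Proof. by move=> f; apply: mpseriesP => m /=; rewrite mul1r. Qed.
Fact mpsscaleDr : right_distributive mpsscale +%R.
Proof. by move=> a f g; apply: mpseriesP => m /=; rewrite mulrDr. Qed.
Fact mpsscaleDl f : {morph mpsscale^~ f : a b / a + b}.
Proof. by move=> a b; apply: mpseriesP => m /=; rewrite mulrDl. Qed.

HB.instance Definition _ := GRing.Zmodule_isLmodule.Build K (mpseries H K)
  mpsscaleA mpsscale1 mpsscaleDr mpsscaleDl.

Lemma mpcoefZ c f m : (c *: f)@_m = c * f@_m. Proof. by []. Qed.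

Definition mpsvar (i : H) : mpseries H K :=
  MPSeries (fun m => (m == eunit i)%:R).

Lemma mpcoefX0 f k m : f@_0 = 0 -> (edeg m < k)%N -> (f ^+ k)@_m = 0.
Proof.
move=> f0; elim: k m => // k IHk m lt_mk; rewrite exprS mpcoefM big_seq big1 //.
move=> a; rewrite mem_ebelow => le_am.
have [->|a_neq0] := eqVneq a 0; first by rewrite f0 mul0r.
rewrite IHk ?mulr0 //; move: a_neq0; rewrite -edeg_eq0 -lt0n => a_gt0.
rewrite -ltnS (leq_trans _ lt_mk) // ltnS -(edeg_sub le_am) -addn1 addnC.
by rewrite leq_add2r.
Qed.

End Ring.

Section Power.
Variables (H : finType) (K : fieldType).
Implicit Types f g : mpseries H K.

(* exp g = sum_(k >= 0) g^k / k! for g with constant term 0.  By mpcoefX0 the *)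
(* terms with k > edeg m contribute nothing to the coefficient at m, so the   *)
(* infinite sum may be cut off there; likewise for the logarithm below.       *)
Definition mpsexp g : mpseries H K :=
  MPSeries (fun m => \sum_(0 <= k < (edeg m).+1) (k`!%:R)^-1 * (g ^+ k)@_m).

(* log f = sum_(k >= 1) (-1)^(k-1) (f - 1)^k / k for f with constant term 1.  *)
Definition mpslog f : mpseries H K :=
  MPSeries (fun m =>
    \sum_(1 <= k < (edeg m).+1) (-1) ^+ k.-1 / k%:R * ((f - 1) ^+ k)@_m).

(* Only meaningful when f has constant term 1 and K has characteristic 0.     *)
Definition mpspow f (alpha : K) : mpseries H K := mpsexp (alpha *: mpslog f).

End Power.

Notation "''w_' i" := (mpsvar _ i) (at level 8, i at level 2, format "''w_' i")
  : ring_scope.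
Notation "f `^^ a" := (mpspow f a) (at level 30, no associativity) : ring_scope.

(* Matrices indexed by H are functions H -> H -> K; they are transported to   *)
(* 'M_#|H| along the enumeration of H.                                        *)
Section IndexedMatrices.
Variables (H : finType) (K : fieldType).
Implicit Types A B : H -> H -> K.

Definition mx_of A : 'M[K]_#|H| := \matrix_(i, j) A (enum_val i) (enum_val j).

Definition det_of A : K := \det (mx_of A).

Definition inv_of A : H -> H -> K :=
  fun i j => invmx (mx_of A) (enum_rank i) (enum_rank j).

Definition mul_of A B : H -> H -> K := fun i j => \sum_(k : H) A i k * B k j.

End IndexedMatrices.

Section Systems.
Variables (H : finType) (K : fieldType).
Implicit Types (D G : H -> H -> K) (Q : H -> mpseries H K).

Definition constants_one Q : Prop := forall i, (Q i)@_0 = 1.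

Definition implicit_system D G Q : Prop :=
  forall i, \prod_(j : H) (Q j `^^ D i j)
            + 'w_i * \prod_(j : H) (Q j `^^ G i j) = 1.

Definition reduced_system G Q : Prop :=
  forall i, Q i + 'w_i * \prod_(j : H) (Q j `^^ G i j) = 1.

End Systems.

(* Main.v *)
Require Import Defs.
From HB Require Import structures.
From mathcomp Require Import all_boot all_order all_algebra.
From mathcomp Require Import boolp reals.
From mathcomp.real_closed Require Import complex.

Set Implicit Arguments.
Unset Strict Implicit.
Unset Printing Implicit Defensive.

Import GRing.Theory.
Local Open Scope ring_scope.
Local Open Scope complex_scope.

(** The powers in both systems become linear after taking logarithms: writing
    [mxpow A Q] for the family of products of the [Q j `^^ A i j], one has
    [mxpow A (mxpow B Q) = mxpow (A B) Q] and [mxpow 1 Q = Q] for families with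
    constant terms 1.  Since [D] is invertible, [Q |-> mxpow D Q] is therefore
    a bijection of such families, with inverse [mxpow D^-1].  As
    [(G D^-1) D = G], it carries the solutions of the implicit system for
    [(D, G)] to those of the reduced system for [G D^-1]
    ([implicit_reducedP]), which gives the formula for [Q] in terms of [Q']
    and leaves only the reduced system to solve.

    The reduced system is a fixed point equation
    [Q i = 1 - w_i * mxpow G Q i].  Multiplication by [w_i] shifts degrees, so
    if two families agree in degrees below [N], their images agree in degrees
    below [N + 1] ([reduced_step_contract]).  Hence the fixed point is unique,
    and its coefficients can be read off the iterates starting from 1.

    The laws of powers rest on [exp] turning sums into products and being
    inverse to [log].  They are obtained without identities between the
    coefficients, from the Euler derivation [euler], the sum of the
    [w_i d/dw_i], which multiplies a monomial by its total degree.  In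
    characteristic 0 an equation [euler y = u * y] with [u] free of constant
    term determines [y] from its constant term ([euler_ode_uniq]), and both
    [exp] and [log] have the expected logarithmic derivatives ([euler_exp],
    [euler_log]). *)

(** * Truncated equality of power series *)

Section Truncation.
Variables (H : finType) (K : comNzRingType).
Implicit Types f g h : mpseries H K.

Lemma mpscaleAl (c : K) f g : c *: (f * g) = (c *: f) * g.
Proof.
apply: mpseriesP => m; rewrite mpcoefZ !mpcoefM mulr_sumr.
by apply: eq_bigr => a _; rewrite mulrA.
Qed.

Lemma mpscaleAr (c : K) f g : c *: (f * g) = f * (c *: g).
Proof. by rewrite mulrC mpscaleAl mulrC. Qed.

Lemma mpcoef_sum I (r : seq I) P (F : I -> mpseries H K) m :
  (\sum_(k <- r | P k) F k)@_m = \sum_(k <- r | P k) (F k)@_m.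
Proof. by apply: (big_morph (fun f => f@_m)). Qed.

Lemma edeg0 : edeg (0 : {ffun H -> nat}) = 0%N.
Proof. by apply/eqP; rewrite edeg_eq0. Qed.

Lemma ebelow0 : ebelow (0 : {ffun H -> nat}) = [:: 0].
Proof.
apply: perm_small_eq => //; apply: uniq_perm; rewrite ?ebelow_uniq //.
move=> a; rewrite mem_ebelow inE; apply/eleP/eqP => [le_a0 | -> //].
by apply/ffunP=> i; have := le_a0 i; rewrite ffunE leqn0 => /eqP.
Qed.

Lemma mpcoef0M f g : (f * g)@_0 = f@_0 * g@_0.
Proof. by rewrite mpcoefM ebelow0 big_seq1 esub0. Qed.

(** Congruence modulo the [N]-th power of the ideal generated by the
    variables.  Infinite sums such as [mpsexp] and [mpslog] are handled by
    comparing them to polynomials up to an arbitrary [N]. *)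
Definition agree N f g := forall m, (edeg m < N)%N -> f@_m = g@_m.

Lemma agreexx N f : agree N f f.
Proof. by []. Qed.

Lemma agree_sym N f g : agree N f g -> agree N g f.
Proof. by move=> fg m /fg. Qed.

Lemma agree_trans N g f h : agree N f g -> agree N g h -> agree N f h.
Proof. by move=> fg gh m mN; rewrite fg ?gh. Qed.

Lemma agree_leq M N f g : (M <= N)%N -> agree N f g -> agree M f g.
Proof. by move=> MN fg m mM; apply: fg; apply: leq_trans mM MN. Qed.

Lemma agree_eq f g : (forall N, agree N f g) -> f = g.
Proof. by move=> fg; apply: mpseriesP => m; apply: (fg (edeg m).+1). Qed.

Lemma agreeB N f f' g g' :
  agree N f f' -> agree N g g' -> agree N (f - g) (f' - g').
Proof. by move=> ff gg m mN; rewrite !mpcoefB ff ?gg. Qed.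

Lemma agreeZ N c f g : agree N f g -> agree N (c *: f) (c *: g).
Proof. by move=> fg m mN; rewrite !mpcoefZ fg. Qed.

Lemma agreeM N f f' g g' :
  agree N f f' -> agree N g g' -> agree N (f * g) (f' * g').
Proof.
move=> ff gg m mN; rewrite !mpcoefM !big_seq; apply: eq_bigr => a.
rewrite mem_ebelow => /edeg_sub am.
by rewrite ff ?gg //; apply: leq_ltn_trans mN; rewrite -am ?leq_addr ?leq_addl.
Qed.

Lemma agreeX N k f g : agree N f g -> agree N (f ^+ k) (g ^+ k).
Proof.
by move=> fg; elim: k => [|k IHk]; rewrite ?expr0 // !exprS; apply: agreeM.
Qed.

Lemma agree_prod N I (r : seq I) (F F' : I -> mpseries H K) :
  (forall i, agree N (F i) (F' i)) ->
  agree N (\prod_(i <- r) F i) (\prod_(i <- r) F' i).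
Proof.
by move=> FF; elim/big_ind2: _ => // f f' g g'; apply: agreeM.
Qed.

(** A factor without constant term raises the order of agreement by one; this
    is what makes the reduced system contracting. *)
Lemma agreeMl N h f g : h@_0 = 0 -> agree N f g -> agree N.+1 (h * f) (h * g).
Proof.
move=> h0 fg m mN; rewrite !mpcoefM !big_seq; apply: eq_bigr => a.
rewrite mem_ebelow => /edeg_sub am.
have [->|a_neq0] := eqVneq a 0; first by rewrite h0 !mul0r.
rewrite fg //; rewrite -ltnS; apply: leq_trans mN; rewrite -am ltnS.
by rewrite -addn1 addnC leq_add2r lt0n edeg_eq0.
Qed.

End Truncation.

Arguments agree {H K} N f g.
Arguments agree_trans {H K N} g {f h}.

(** * The Euler derivation *)

Section Euler.
Variables (H : finType) (K : comNzRingType).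
Implicit Types f g : mpseries H K.

Definition euler f : mpseries H K := MPSeries (fun m => f@_m *+ edeg m).

Fact euler_linear : linear euler.
Proof.
move=> c f g; apply: mpseriesP => m.
by rewrite mpcoefD mpcoefZ /= mulrnDl mulrnAr.
Qed.

HB.instance Definition _ :=
  GRing.isLinear.Build K (mpseries H K) (mpseries H K) *:%R euler euler_linear.

Lemma euler1 : euler 1 = 0.
Proof.
apply: mpseriesP => m /=; have [->|] := eqVneq m 0; last by rewrite mul0rn.
by rewrite edeg0.
Qed.

Lemma eulerM f g : euler (f * g) = euler f * g + f * euler g.
Proof.
apply: mpseriesP => m; rewrite mpcoefD !mpcoefM /= -sumrMnl.
rewrite -big_split /= !big_seq.
apply: eq_bigr => a; rewrite mem_ebelow => /edeg_sub <-.
by rewrite mulrnDr mulrnAl mulrnAr.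
Qed.

Lemma eulerX f k : euler (f ^+ k.+1) = k.+1%:R *: (f ^+ k * euler f).
Proof.
elim: k => [|k IHk]; first by rewrite expr1 expr0 mul1r scale1r.
rewrite exprS eulerM IHk -mpscaleAr mulrA -exprS mulrC -[k.+2]addn1 natrD.
by rewrite scalerDl scale1r addrC.
Qed.

Lemma euler_coef0 f : (euler f)@_0 = 0.
Proof. by rewrite /= edeg0. Qed.

Lemma agree_euler N f g : agree N f g -> agree N (euler f) (euler g).
Proof. by move=> fg m mN; rewrite /= fg. Qed.

End Euler.

(** * Exponential and logarithm *)

Section ExpLog.
Variables (H : finType) (K : fieldType).
Hypothesis char0 : [pchar K] =i pred0.
Implicit Types (f g h : mpseries H K) (A B G : H -> H -> K).
Implicit Types Q P : H -> mpseries H K.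

Let natr_neq0 n : n.+1%:R != 0 :> K.
Proof. by move/pcharf0P: char0 => ->. Qed.

(** At a monomial of degree [d > 0] the equation reads [d * f_m = (u * f)_m],
    and the right-hand side only involves coefficients of [f] in degrees below
    [d], because [u] has no constant term. *)
Lemma euler_ode_uniq u f g : u@_0 = 0 -> f@_0 = g@_0 ->
  euler f = u * f -> euler g = u * g -> f = g.
Proof.
move=> u0 fg0 Ef Eg; apply: agree_eq; elim=> [//|N IHN] m mN.
have [->|] := eqVneq m 0; first exact: fg0.
rewrite -edeg_eq0; case md: (edeg m) => [//|d] _.
have: (euler f)@_m = (euler g)@_m by rewrite Ef Eg (agreeMl u0 IHN).
rewrite /= md -[_ *+ _]mulr_natr -[in RHS]mulr_natr.
exact: mulIf.
Qed.

Lemma euler_inj f g : f@_0 = g@_0 -> euler f = euler g -> f = g.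
Proof.
move=> fg0 Efg; apply/eqP; rewrite -subr_eq0; apply/eqP.
apply: (@euler_ode_uniq 0); rewrite ?mul0r ?linear0 //.
  by rewrite mpcoefB fg0 subrr.
by rewrite linearB /= Efg subrr.
Qed.

Definition exp_trunc N g : mpseries H K :=
  \sum_(0 <= k < N) (k`!%:R)^-1 *: g ^+ k.

(** The upper bound [N] is included so that the derivative involves the
    geometric sum of exactly [N] terms (see [euler_log_trunc]). *)
Definition log_trunc N f : mpseries H K :=
  \sum_(1 <= k < N.+1) ((-1) ^+ k.-1 / k%:R) *: (f - 1) ^+ k.

Lemma mpsexp_trunc N g : g@_0 = 0 -> agree N (mpsexp g) (exp_trunc N g).
Proof.
move=> g0 m mN; rewrite mpcoef_sum /= (@big_cat_nat _ _ _ (edeg m).+1 0 N) //=.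
rewrite [X in _ = _ + X]big_nat [X in _ = _ + X]big1 ?addr0 // => k /andP[mk _].
by rewrite mpcoefX0 ?mulr0.
Qed.

Lemma mpslog_trunc N f : f@_0 = 1 -> agree N.+1 (mpslog f) (log_trunc N f).
Proof.
move=> f0 m mN; have f10: (f - 1)@_0 = 0.
  by rewrite mpcoefB f0 mpcoef1 eqxx subrr.
rewrite mpcoef_sum /= (@big_cat_nat _ _ _ (edeg m).+1 1 N.+1) //=.
rewrite [X in _ = _ + X]big_nat [X in _ = _ + X]big1 ?addr0 // => k /andP[mk _].
by rewrite mpcoefX0 ?mulr0.
Qed.

(** Unlike the comparison with the truncated polynomials, this and
    [agree_log] hold for any constant terms, since the sums are cut off
    according to the degree of the monomial alone.  Thus iterates of the
    reduced system can be compared before their constant terms are known. *)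
Lemma agree_exp N f g : agree N f g -> agree N (mpsexp f) (mpsexp g).
Proof.
by move=> fg m mN; apply: eq_bigr => k _; rewrite (agreeX k fg).
Qed.

Lemma agree_log N f g : agree N f g -> agree N (mpslog f) (mpslog g).
Proof.
move=> fg m mN; apply: eq_bigr => k _.
by rewrite (agreeX k (agreeB fg (agreexx (1 : mpseries H K)))).
Qed.

Lemma agree_pow N f g a : agree N f g -> agree N (f `^^ a) (g `^^ a).
Proof. by move=> fg; apply/agree_exp/agreeZ/agree_log. Qed.

Lemma mpsexp_coef0 g : (mpsexp g)@_0 = 1.
Proof. by rewrite /= edeg0 big_nat1 expr0 mpcoef1 eqxx invr1 mulr1. Qed.

Lemma mpslog_coef0 f : (mpslog f)@_0 = 0.
Proof. by rewrite /= edeg0 big_geq. Qed.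

Lemma euler_exp_trunc N g :
  euler (exp_trunc N.+1 g) = euler g * exp_trunc N g.
Proof.
rewrite /exp_trunc big_nat_recl // expr0.
rewrite linearD linearZ /= euler1 scaler0 add0r.
rewrite linear_sum mulr_sumr; apply: eq_bigr => k _ /=.
rewrite linearZ /= eulerX scalerA factS natrM invfM mulrAC mulVf // mul1r.
by rewrite -mpscaleAr [euler g * _]mulrC.
Qed.

Lemma euler_exp g : g@_0 = 0 -> euler (mpsexp g) = euler g * mpsexp g.
Proof.
move=> g0; apply: agree_eq => N.
apply: (agree_trans (euler (exp_trunc N.+1 g))).
  apply/agree_euler/agree_leq/mpsexp_trunc => //.
rewrite euler_exp_trunc; apply: agreeM => //.
exact/agree_sym/mpsexp_trunc.
Qed.

(** The derivative of the logarithm is [euler f] times a geometric sum of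
    ratio [1 - f], which multiplication by [f = 1 - (1 - f)] telescopes. *)
Lemma euler_log_trunc N f :
  f * euler (log_trunc N f) = (1 - (1 - f) ^+ N) * euler f.
Proof.
have -> : euler (log_trunc N f) = (\sum_(k < N) (1 - f) ^+ k) * euler f.
  rewrite /log_trunc big_add1 /= big_mkord linear_sum mulr_suml.
  apply: eq_bigr => k _; rewrite linearZ /= eulerX linearB /= euler1 subr0.
  rewrite scalerA divfK // mpscaleAl; congr (_ * _).
  rewrite -[1 - f]opprB [RHS]exprNn -signr_odd -[in RHS]signr_odd.
  by case: odd; rewrite ?expr1 ?expr0 ?scaleN1r ?scale1r ?mulN1r ?mul1r.
rewrite mulrA; congr (_ * _).
by rewrite -[RHS]opprB subrX1 -mulNr opprB subKr.
Qed.

Lemma euler_log f : f@_0 = 1 -> f * euler (mpslog f) = euler f.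
Proof.
move=> f0; apply: agree_eq => N.
apply: (agree_trans (f * euler (log_trunc N f))).
  apply/agreeM/agree_euler => //; exact/agree_leq/mpslog_trunc.
rewrite euler_log_trunc -[X in agree _ _ X]mul1r; apply: agreeM => //.
move=> m mN; rewrite mpcoefB mpcoefX0 ?subr0 //.
by rewrite mpcoefB f0 mpcoef1 eqxx subrr.
Qed.

Lemma mpsexp0 : mpsexp (0 : mpseries H K) = 1.
Proof.
apply: (@euler_ode_uniq 0); rewrite ?mpsexp_coef0 ?mpcoef1 ?eqxx //.
  by rewrite euler_exp // linear0.
by rewrite euler1 mul0r.
Qed.

(** Both sides solve [euler y = (euler g + euler h) * y]. *)
Lemma mpsexpD g h : g@_0 = 0 -> h@_0 = 0 ->
  mpsexp (g + h) = mpsexp g * mpsexp h.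
Proof.
move=> g0 h0; apply: (@euler_ode_uniq (euler g + euler h)).
- by rewrite mpcoefD !euler_coef0 addr0.
- by rewrite mpcoef0M !mpsexp_coef0 mulr1.
- by rewrite euler_exp ?mpcoefD ?g0 ?h0 ?addr0 // linearD.
- by rewrite eulerM !euler_exp // mulrDl -mulrA; congr (_ + _); exact: mulrCA.
Qed.

(** Both sides solve [euler y = euler (mpslog f) * y]. *)
Lemma mpslogK f : f@_0 = 1 -> mpsexp (mpslog f) = f.
Proof.
move=> f0; apply: (@euler_ode_uniq (euler (mpslog f))).
- exact: euler_coef0.
- by rewrite mpsexp_coef0.
- by rewrite euler_exp ?mpslog_coef0.
- by rewrite mulrC euler_log.
Qed.

(** Both sides have the same image under [euler]: multiply by [mpsexp g] and
    cancel this unit. *)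
Lemma mpsexpK g : g@_0 = 0 -> mpslog (mpsexp g) = g.
Proof.
move=> g0; apply: euler_inj; first by rewrite mpslog_coef0.
have expVg : mpsexp (- g) * mpsexp g = 1.
  by rewrite -mpsexpD ?addNr ?mpsexp0 // mpcoefN g0 oppr0.
rewrite -[LHS]mul1r -expVg -mulrA euler_log ?mpsexp_coef0 // euler_exp //.
by rewrite mulrCA expVg mulr1.
Qed.

Lemma mpsexp_sum I (r : seq I) (F : I -> mpseries H K) :
  (forall i, (F i)@_0 = 0) ->
  mpsexp (\sum_(i <- r) F i) = \prod_(i <- r) mpsexp (F i).
Proof.
move=> F0; elim: r => [|i r IHr]; first by rewrite !big_nil mpsexp0.
by rewrite !big_cons mpsexpD ?IHr // mpcoef_sum big1.
Qed.

(** * Monomials in power series with a matrix of exponents *)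

Definition mxpow (A : H -> H -> K) (Q : H -> mpseries H K) i :=
  \prod_(j : H) (Q j `^^ A i j).

Definition id_of (i j : H) : K := (i == j)%:R.

Lemma mxpowE A Q i : mxpow A Q i = mpsexp (\sum_j A i j *: mpslog (Q j)).
Proof.
by rewrite mpsexp_sum // => j; rewrite mpcoefZ mpslog_coef0 mulr0.
Qed.

Lemma mxpow_constants_one A Q : constants_one (mxpow A Q).
Proof. by move=> i; rewrite mxpowE mpsexp_coef0. Qed.

Lemma mpslog_mxpow A Q i :
  mpslog (mxpow A Q i) = \sum_j A i j *: mpslog (Q j).
Proof.
rewrite mxpowE mpsexpK // mpcoef_sum big1 // => j _.
by rewrite mpcoefZ mpslog_coef0 mulr0.
Qed.

(** In logarithmic coordinates [mxpow A] is the linear map of matrix [A], so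
    composition becomes the matrix product. *)
Lemma mxpow_comp A B Q : mxpow A (mxpow B Q) = mxpow (mul_of A B) Q.
Proof.
apply/funext => i; rewrite [LHS]mxpowE [RHS]mxpowE.
apply: (congr1 (@mpsexp H K)).
under eq_bigr do rewrite mpslog_mxpow scaler_sumr.
rewrite exchange_big; apply: eq_bigr => j _ /=.
by rewrite scaler_suml; apply: eq_bigr => k _; rewrite scalerA.
Qed.

Lemma mxpow1 Q : constants_one Q -> mxpow id_of Q = Q.
Proof.
move=> Q1; apply/funext => i; rewrite mxpowE (bigD1 i) //= /id_of eqxx scale1r.
rewrite big1 ?addr0 ?mpslogK // => j /negPf ji.
by rewrite eq_sym ji scale0r.
Qed.

(** * The reduced system *)

Definition reduced_step (G : H -> H -> K) Q i : mpseries H K :=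
  1 - 'w_i * mxpow G Q i.

Lemma reduced_systemE G Q : reduced_system G Q <-> reduced_step G Q = Q.
Proof.
split=> [GQ | stepQ i].
  by apply/funext => i; rewrite /reduced_step -(GQ i) addrK.
by rewrite -[X in X + _](congr1 (@^~ i) stepQ) /reduced_step subrK.
Qed.

Lemma mpsvar0 i : ('w_i : mpseries H K)@_0 = 0.
Proof.
rewrite /=; case: eqP => // /ffunP/(_ i); by rewrite !ffunE eqxx.
Qed.

Lemma reduced_step_contract G N Q Q' : (forall i, agree N (Q i) (Q' i)) ->
  forall i, agree N.+1 (reduced_step G Q i) (reduced_step G Q' i).
Proof.
move=> QQ i; apply: (agreeB (agreexx _)); apply: agreeMl.
  exact: mpsvar0.
by apply: agree_prod => j; apply: agree_pow.
Qed.

Lemma reduced_step_constants_one G Q : constants_one (reduced_step G Q).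
Proof.
by move=> i; rewrite mpcoefB mpcoef0M mpsvar0 mul0r subr0 mpcoef1 eqxx.
Qed.

Lemma reduced_uniq G Q P : reduced_system G Q -> reduced_system G P -> Q = P.
Proof.
move=> /reduced_systemE sQ /reduced_systemE sP; apply/funext => i.
apply: agree_eq => N; elim: N i => [//|N IHN] i; rewrite -sQ -sP.
exact: reduced_step_contract.
Qed.

(** The [n]-th iterate is correct in degrees below [n], so the coefficient of
    the solution at [m] is that of the iterate of rank [edeg m + 1]. *)
Lemma reduced_exists G : exists Q, constants_one Q /\ reduced_system G Q.
Proof.
have [it itS] : exists it : nat -> H -> mpseries H K,
    forall n, it n.+1 = reduced_step G (it n).
  by exists (fun n => iter n (reduced_step G) (fun=> 1)).
have it_agree n i k : agree n (it n i) (it (n + k)%N i).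
  elim: n i k => [//|n IHn] i k; rewrite addSn !itS.
  by apply: reduced_step_contract.
pose Q i := MPSeries (fun m => (it (edeg m).+1 i)@_m).
have Q_agree n i : agree n (Q i) (it n i).
  move=> m mn; have := it_agree _ i (n - (edeg m).+1)%N m (ltnSn _).
  by rewrite (subnKC mn).
have stepQ : reduced_step G Q = Q.
  apply/funext => i; apply: agree_eq => n.
  (* Both sides agree with it n.+1 even below degree n + 1. *)
  apply: (agree_trans (it n.+1 i)).
    by apply: agree_leq (leqnSn n) _; rewrite itS; apply: reduced_step_contract.
  by apply: agree_sym; apply: agree_leq (leqnSn n) _; apply: Q_agree.
exists Q; split; last exact/reduced_systemE.
by rewrite -stepQ; apply: reduced_step_constants_one.
Qed.

End ExpLog.

(** * Inverse of an indexed matrix *)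

Section Inverse.
Variables (H : finType) (K : fieldType).
Implicit Types A B C : H -> H -> K.

Lemma mul_ofA A B C : mul_of A (mul_of B C) = mul_of (mul_of A B) C.
Proof.
apply/funext => i; apply/funext => j; rewrite /mul_of.
under eq_bigr do rewrite mulr_sumr.
rewrite exchange_big; apply: eq_bigr => l _; rewrite mulr_suml.
by apply: eq_bigr => k _; rewrite mulrA.
Qed.

Lemma mul_of_id A : mul_of A (@id_of H K) = A.
Proof.
apply/funext => i; apply/funext => j; rewrite /mul_of (bigD1 j) //= /id_of eqxx.
by rewrite mulr1 big1 ?addr0 // => k /negPf->; rewrite mulr0.
Qed.

Lemma mul_of_mx A B i j :
  mul_of A B i j = (mx_of A *m mx_of B) (enum_rank i) (enum_rank j).
Proof.
rewrite mxE /mul_of (reindex (fun k : 'I_#|H| => enum_val k)) /=; last first.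
  exact/onW_bij/enum_val_bij.
by apply: eq_bigr => k _; rewrite !mxE !enum_rankK.
Qed.

Lemma mx_of_inv A : mx_of (inv_of A) = invmx (mx_of A).
Proof. by apply/matrixP => i j; rewrite mxE /inv_of !enum_valK. Qed.

Lemma mul_of_invl A : det_of A != 0 -> mul_of (inv_of A) A = @id_of H K.
Proof.
move=> detA; apply/funext => i; apply/funext => j.
rewrite mul_of_mx mx_of_inv mulVmx ?unitmxE ?unitfE // mxE.
by rewrite (inj_eq enum_rank_inj).
Qed.

Lemma mul_of_invr A : det_of A != 0 -> mul_of A (inv_of A) = @id_of H K.
Proof.
move=> detA; apply/funext => i; apply/funext => j.
rewrite mul_of_mx mx_of_inv mulmxV ?unitmxE ?unitfE // mxE.
by rewrite (inj_eq enum_rank_inj).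
Qed.

End Inverse.

(** * Reduction of the implicit system *)

Lemma implicit_reducedP (H : finType) (K : fieldType)
    (char0 : [pchar K] =i pred0) (D G : H -> H -> K)
    (Q : H -> mpseries H K) : det_of D != 0 ->
  implicit_system D G Q <->
  reduced_system (mul_of G (inv_of D)) (mxpow D Q).
Proof.
move=> detD.
have eqG : mxpow (mul_of G (inv_of D)) (mxpow D Q) = mxpow G Q.
  by rewrite (mxpow_comp char0) -mul_ofA (mul_of_invl detD) mul_of_id.
have -> : reduced_system (mul_of G (inv_of D)) (mxpow D Q) =
    forall i, mxpow D Q i
              + 'w_i * mxpow (mul_of G (inv_of D)) (mxpow D Q) i = 1.
  exact: erefl.
rewrite eqG; exact: iff_refl.
Qed.

Unset Implicit Arguments.

Theorem theorem2p3 (R : realType) (H : finType) (D G : H -> H -> R[i])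
    (detD_neq0 : det_of D != 0) :
  let G' := mul_of G (inv_of D) in
  [/\ exists! Q : H -> mpseries H R[i],
        constants_one Q /\ implicit_system D G Q,
      exists! Q' : H -> mpseries H R[i],
        constants_one Q' /\ reduced_system G' Q'
    & forall Q Q' : H -> mpseries H R[i],
        constants_one Q /\ implicit_system D G Q ->
        constants_one Q' /\ reduced_system G' Q' ->
        forall i : H, Q i = \prod_(j : H) (Q' j `^^ inv_of D i j)].
Proof.
move=> G'; have char0 : [pchar R[i]] =i pred0 by exact: Num.Theory.pchar_num.
have [Q' [Q'1 sQ']] := @reduced_exists H _ G'.
have solE Q P : constants_one Q /\ implicit_system D G Q ->
    reduced_system G' P -> Q = mxpow (inv_of D) P.
  move=> [Q1 /(implicit_reducedP char0 _ _ detD_neq0) sQ] sP.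
  rewrite -(reduced_uniq sQ sP) (mxpow_comp char0) (mul_of_invl detD_neq0).
  by rewrite mxpow1.
split.
- exists (mxpow (inv_of D) Q'); split=> [|Q sQ]; last exact/esym/solE.
  split; first exact: mxpow_constants_one.
  apply/(implicit_reducedP char0 _ _ detD_neq0).
  by rewrite (mxpow_comp char0) (mul_of_invr detD_neq0) (mxpow1 char0 Q'1).
- by exists Q'; split=> // P [_ sP]; apply: reduced_uniq sP.
- by move=> Q P sQ [_ sP] i; rewrite (solE Q P).
Qed.
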